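(* Let $\mathcal{M}$ be a von Neumann algebra with no central summands of type $\mathrm{I}_1$, and let $\xi$ be a (complex) scalar with $\xi\neq 0,1$. If $\Phi:\mathcal{M}\rightarrow\mathcal{M}$ is a nonlinear $\xi$-Lie derivation, i.e. a map (not assumed additive or linear) satisfying $\Phi([T,S]_{\xi})=[\Phi(T),S]_{\xi}+[T,\Phi(S)]_{\xi}$ for all $T,S\in\mathcal{M}$, then $\Phi$ is an additive derivation and $\Phi(\xi T)=\xi\Phi(T)$ for all $T\in\mathcal{M}$.
   Context: A von Neumann algebra $\mathcal{M}$ is a weakly closed, self-adjoint algebra of bounded operators on a complex Hilbert space $H$ containing the identity operator $I$. ''No central summands of type $\mathrm{I}_1$'' means that there is no nonzero central projection $Q\in\mathcal{M}$ such that $Q\mathcal{M}$ is commutative. For a scalar $\xi$ and $x,y\in\mathcal{M}$, the $\xi$-Lie product is $[x,y]_{\xi}=xy-\xi yx$. A nonlinear $\xi$-Lie derivation is a map $\Phi:\mathcal{M}\to\mathcal{M}$, with no additivity, linearity or continuity assumed, satisfying the displayed identity. An additive derivation is an additive map $\delta:\mathcal{M}\to\mathcal{M}$ with $\delta(xy)=\delta(x)y+x\delta(y)$ for all $x,y\in\mathcal{M}$. *)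

(* Defs.v *)
From HB Require Import structures.
From mathcomp Require Import all_boot all_order all_algebra.
From mathcomp Require Export sesquilinear.
From mathcomp Require Export complex.
From mathcomp Require Import all_classical all_reals all_analysis.

Set Implicit Arguments.
Unset Strict Implicit.
Unset Printing Implicit Defensive.

Import Order.TTheory GRing.Theory Num.Theory.
Import numFieldNormedType.Exports.

Local Open Scope classical_set_scope.
Local Open Scope ring_scope.

(* The norm takes values in [K], so [k] is automatically real unless [H = 0]. *)
Definition bounded_linear (K : numFieldType) (H : normedModType K) :
    {pred H -> H} :=
  fun f => `[< linear f /\ exists k : K, forall x, `|f x| <= k * `|x| >].

Record bounded_operator (K : numFieldType) (H : normedModType K) :=
  BoundedOperator { operator_fun :> H -> H;
                    _ : operator_fun \in @bounded_linear K H }.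

HB.instance Definition _ (K : numFieldType) (H : normedModType K) :=
  [isSub for @operator_fun K H].
HB.instance Definition _ (K : numFieldType) (H : normedModType K) :=
  [Choice of bounded_operator H by <:].

Section BoundedOperatorRing.
Variables (K : numFieldType) (H : normedModType K).
Implicit Types (f : H -> H) (S T : bounded_operator H).

Lemma bounded_linearP f : f \in @bounded_linear K H <->
  linear f /\ exists2 k : K, 0 <= k & forall x, `|f x| <= k * `|x|.
Proof.
rewrite /in_mem /=; split=> [/asboolP[lf [k fk]]|[lf [k _ fk]]]; last first.
  by apply/asboolP; split=> //; exists k.
split=> //; exists `|k| => // x; have [x0|x0] := eqVneq `|x| 0.
  by have := fk x; rewrite x0 !mulr0.
have xgt0 : 0 < `|x| by rewrite lt_neqAle eq_sym x0 normr_ge0.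
have k0 : 0 <= k by rewrite -(pmulr_lge0 _ xgt0) (le_trans _ (fk x)).
by rewrite ger0_norm.
Qed.

Lemma operator_linear T : linear T.
Proof. by have /bounded_linearP[] := valP T. Qed.

Lemma operator_bounded T :
  exists2 k : K, 0 <= k & forall x, `|T x| <= k * `|x|.
Proof. by have /bounded_linearP[] := valP T. Qed.

Lemma bounded_linear_subsemimod_closed :
  GRing.subsemimod_closed (@bounded_linear K H).
Proof.
apply: GRing.submod_closed_semi; split.
  apply/bounded_linearP; split; first by move=> a x y; rewrite scaler0 addr0.
  by exists 0 => // x; rewrite normr0 mul0r.
move=> a f g /bounded_linearP[lf [k k0 fk]] /bounded_linearP[lg [l l0 gl]].
apply/bounded_linearP; split.
  move=> b x y; rewrite addrfctE scalrfctE /= lf lg.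
  rewrite !scalerDr !scalerA (mulrC a b) -!addrA; congr (_ + _).
  by rewrite addrCA.
exists (`|a| * k + l); first by rewrite addr_ge0 ?mulr_ge0.
move=> x; rewrite addrfctE scalrfctE mulrDl (le_trans (ler_normD _ _))//.
by rewrite lerD ?gl// normrZ -mulrA ler_wpM2l.
Qed.

HB.instance Definition _ :=
  GRing.SubChoice_isSubLmodule.Build K (H -> H) (@bounded_linear K H)
    (bounded_operator H) bounded_linear_subsemimod_closed.

Lemma bounded_linear_id : (id : H -> H) \in @bounded_linear K H.
Proof. by apply/bounded_linearP; split=> //; exists 1 => // x; rewrite mul1r. Qed.

Lemma bounded_linear_comp S T : (S \o T) \in @bounded_linear K H.
Proof.
have [[k k0 Sk] [l l0 Tl]] := (operator_bounded S, operator_bounded T).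
apply/bounded_linearP; split.
  by move=> a x y; rewrite /= !operator_linear.
exists (k * l); first exact: mulr_ge0.
by move=> x; rewrite (le_trans (Sk _))// -mulrA ler_wpM2l.
Qed.

Definition operator_one := BoundedOperator bounded_linear_id.
Definition operator_mul S T := BoundedOperator (bounded_linear_comp S T).

Let mulA : associative operator_mul.
Proof. by move=> S T U; exact: val_inj. Qed.
Let mul1 : left_id operator_one operator_mul.
Proof. by move=> S; exact: val_inj. Qed.
Let mulr1 : right_id operator_one operator_mul.
Proof. by move=> S; exact: val_inj. Qed.
Let mulDl : left_distributive operator_mul +%R.
Proof. by move=> S T U; exact: val_inj. Qed.
Let mulDr : right_distributive operator_mul +%R.
Proof.
move=> S T U; apply: val_inj; apply/funext => x /=.
by have := operator_linear S 1 (T x) (U x); rewrite !scale1r.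
Qed.

(* A [pzRingType] and not an [algType], since the latter requires [1 != 0],
   which fails for the zero space. *)
HB.instance Definition _ := GRing.Zmodule_isPzRing.Build (bounded_operator H)
  mulA mul1 mulr1 mulDl mulDr.

End BoundedOperatorRing.

Section VonNeumannAlgebra.
Variables (R : realType) (H : completeNormedModType R[i]).
(* [dot] is linear in its first argument and conjugate-linear in its second. *)
Variable dot : {dot H for (@Num.conj R[i])}.
Local Notation B := (bounded_operator H).
Implicit Types (S T Q : B) (M : set B).

Definition is_adjoint T S := forall x y : H, dot (T x) y = dot x (S y).

(* The coarsest topology making every [T |-> dot (T x) y] continuous. *)
Definition weak_operator_topology :=
  initial_topology
    (fun T => (fun xy => dot (T xy.1) xy.2) : {ptws H * H -> R[i]^o}).

(* In [vn_adjoint], [S] is the adjoint of [T], which is unique. *)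
Record von_neumann_algebra M : Prop := {
  vn_one : M 1;
  vn_add : forall S T, M S -> M T -> M (S + T);
  vn_scale : forall (a : R[i]) T, M T -> M (a *: T);
  vn_mul : forall S T, M S -> M T -> M (S * T);
  vn_adjoint : forall T, M T -> exists2 S, M S & is_adjoint T S;
  vn_closed : closed (M : set weak_operator_topology)
}.

Definition projection Q := Q * Q = Q /\ is_adjoint Q Q.

Definition central M Q := M Q /\ forall T, M T -> Q * T = T * Q.

Definition no_central_summand_of_type_I1 M :=
  ~ exists Q, [/\ projection Q, central M Q, Q != 0 &
     forall S T, M S -> M T -> (Q * S) * (Q * T) = (Q * T) * (Q * S)].

End VonNeumannAlgebra.

Section Derivation.
Variables (K : numFieldType) (H : normedModType K).
Local Notation B := (bounded_operator H).
Implicit Types (M : set B).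

Definition xi_lie (xi : K) (S T : B) : B := S * T - xi *: (T * S).

(* [Phi : {fun M >-> M}] is a function on all bounded operators that maps [M]
   to [M]; everything below only depends on its values on [M]. *)
Definition nonlinear_xi_lie_derivation (xi : K) M (Phi : {fun M >-> M}) :=
  forall T S, M T -> M S ->
    Phi (xi_lie xi T S) = xi_lie xi (Phi T) S + xi_lie xi T (Phi S).

Definition additive_derivation M (Phi : {fun M >-> M}) :=
  (forall S T, M S -> M T -> Phi (S + T) = Phi S + Phi T) /\
  (forall S T, M S -> M T -> Phi (S * T) = Phi S * T + S * Phi T).

End Derivation.

(* Main.v *)
Require Import Defs.
From HB Require Import structures.
From mathcomp Require Import all_boot all_order all_algebra.
From mathcomp Require Import sesquilinear complex.
From mathcomp Require Import all_classical all_reals all_analysis.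
From mathcomp Require Import ring.
From Stdlib Require Ncring Ncring_tac.

(** The theorem splits into a statement about rings and a statement about von
Neumann algebras, linked by one property of a ring [A]: an element [x] such
that [x * (p * s * (1 - p)) = 0] for every idempotent [p] and every [s] is
zero.

Ring part.  Write [[x, y] = x * y - Z (y * x)], where [Z] is multiplication by
the scalar, and let [defect x y = phi (x + y) - phi x - phi y].  Bracketing on
the right with a fixed element is additive, so the identity satisfied by [phi]
gives [defect [x, u] [y, u] = [defect x y, u]] exactly.  Hence a bracket that
kills [x] or [y] kills [defect x y], and, more generally, a chain of brackets
that sends [x] and [y] to elements on which [phi] is additive kills it.  Fix an
idempotent [e] and put [f = 1 - e].  Such chains show that
[defect e (e s f)] lives in the corner [e A e] and annihilates [e A f], and
dually for [defect f (e s f)].  Expanding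
[[e + a, f + b] = a + b] for [a, b] in [e A f] then gives additivity on [e A f]
([defect_corner]), because the two error terms cancel against everything they
meet.  Two four-fold brackets carry an arbitrary element to [e A f] and to
[e A e], and conclude that [defect x y] annihilates [e A f]
([defect_corner0]).  As [e] is arbitrary, [phi] is additive.

Once [phi] is additive, the defect [del] of the Leibniz rule is a Hochschild
cocycle, and the identity expresses [del x y] through [del y x] and
[tau x = phi (Z x) - Z (phi x)].  If [1 + Z] is injective this can be solved:
[tau] and [(1 + Z) del] have explicit expressions, linear in the element
[c = phi 1], which is central, and the cocycle identity says that [c]
annihilates all double commutators.  By semiprimeness it annihilates all
commutators, hence all [p * s * (1 - p)], so [c = 0].  If [Z = -1] then [phi] is
a Jordan derivation, and the classical argument of Herstein and Bresar shows
that [del x y] annihilates all commutators.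

Operator part ([vn_corner_faithful]).  If [X] in [M] annihilates all
[P T (1 - P)], then so does the projection [E] with the same kernel as [X].
Taking [P = E] shows that [E] is central, and then [E (P T - T P) = 0] for all
projections [P] of [M].  Every self-adjoint contraction [A] of [M] is half the
sum of a symmetry [U = 2 P - 1] with [P] in [M] and of another self-adjoint
contraction of [M]; iterating, [2 ^ n E (A T - T A)] stays bounded, so
[E (A T - T A) = 0].  Hence [E M] is commutative, and [E = 0] as [M] has no
central summand of type I_1.

Both [E] and [U] come from the sign of a self-adjoint contraction, obtained
without functional calculus as the strong limit of the Newton iteration
[X |-> X + X (1 - X ^ 2) / 2] ([newton_sign]).  In the scalar case the
iterates have constant sign and increasing absolute value, so that
[(X_m - X_n) ^ 2 <= X_m ^ 2 - X_n ^ 2]; the same inequality between quadratic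
forms makes [X_n x] a Cauchy sequence. *)

Set Implicit Arguments.
Unset Strict Implicit.
Unset Printing Implicit Defensive.

Import Order.TTheory GRing.Theory Num.Theory.
Import numFieldNormedType.Exports.

Local Open Scope classical_set_scope.
Local Open Scope ring_scope.

(** * Identities in noncommutative rings *)

#[local] Instance pz_ops (A : pzRingType) :
  @Ncring.Ring_ops A 0 1 +%R *%R (fun x y => x - y) -%R eq := {}.

#[local] Instance pz_ring (A : pzRingType) : Ncring.Ring (Ro := pz_ops A).
Proof.
constructor; rewrite /Algebra_syntax.equality /=.
all: try by move=> ? ? -> // ? ? ->.
- exact: RelationClasses.eq_equivalence.
- exact: add0r.
- exact: addrC.
- exact: addrA.
- exact: mul1r.
- exact: mulr1.
- exact: mulrA.
- exact: mulrDl.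
- by move=> x y z; exact: mulrDr.
- by [].
- exact: subrr.
Qed.

Local Ltac ncring := Ncring_tac.non_commutative_ring.

Lemma subrr_eq (V : zmodType) (a b : V) : a = b -> b - a = 0.
Proof. by move=> ->; rewrite subrr. Qed.

Lemma idempotent_rules (A : pzRingType) (e f : A) :
    e * e = e -> e * f = 0 -> f * e = 0 -> f * f = f ->
  (e * e = e) * (e * f = 0) * (f * e = 0) * (f * f = f) *
  (forall x, e * (e * x) = e * x) * (forall x, e * (f * x) = 0) *
  (forall x, f * (e * x) = 0) * (forall x, f * (f * x) = f * x).
Proof.
by move=> ee ef fe ff; do !split=> //; move=> x;
  rewrite mulrA ?ee ?ef ?fe ?ff ?mul0r.
Qed.

(** Used to pass from elements annihilating all commutators to elements
annihilating all off-diagonal corners. *)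
Lemma corner_commutator (A : pzRingType) (e s : A) : e * e = e ->
  e * (e * s * (1 - e)) - e * s * (1 - e) * e = e * s * (1 - e).
Proof.
move=> ee; rewrite !mulrA ee !(mulrBr, mulrBl) !mulr1 -!mulrA !ee.
by ncring.
Qed.

(** * The xi-Lie bracket and the additivity of its derivations *)

(** [Z] stands for multiplication by the scalar; it may be any element of the
centroid, so that the arguments take place in a bare ring. *)
Section CentroidBracket.
Variables (A : pzRingType) (Z : {additive A -> A}).
Hypothesis ZMl : forall x y, Z x * y = Z (x * y).
Hypothesis ZMr : forall x y, x * Z y = Z (x * y).

Definition xlie (x y : A) : A := x * y - Z (y * x).

Let expandE := (@mulrDl A, @mulrDr A, @mulNr A, @mulrN A, @opprK A, @opprD A,
  ZMl, ZMr, raddf0 Z, raddfD Z, raddfN Z, @mulr0 A, @mul0r A, @oppr0 A,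
  @addr0 A, @add0r A, @mulr1 A, @mul1r A).

(* Four rounds reach the normal form: the brackets below are nested at most four
   deep. *)
Local Ltac expand_in rules := do 4!rewrite ?expandE -?mulrA ?rules.

Section CornerBrackets.
Variables (e f s : A).
Hypotheses (ee : e * e = e) (ef : e * f = 0) (fe : f * e = 0) (ff : f * f = f).
Let cornerE := idempotent_rules ee ef fe ff.
Let t := e * s * f.

(** The four brackets extract the component [e * x * e] of [x] and move it to
the corner [e A f], where additivity is established first. *)
Lemma xlie_corner11 x :
  xlie (xlie (xlie (xlie x e) t) e) f = - (Z (e * x * t - Z (e * x * t))).
Proof.
rewrite /xlie /t; expand_in cornerE.
by ncring.
Qed.

(** The four brackets extract the component [f * x * e] of [x] and move it to
the corner [e A e]. *)
Lemma xlie_corner21 x :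
  xlie (xlie (xlie (xlie x e) f) t) e = Z (Z (t * x * e - Z (t * x * e))).
Proof.
rewrite /xlie /t; expand_in cornerE.
by ncring.
Qed.
End CornerBrackets.

Lemma xlieDl x y u : xlie (x + y) u = xlie x u + xlie y u.
Proof. by rewrite /xlie !expandE; ncring. Qed.
Lemma xlieDr x y u : xlie u (x + y) = xlie u x + xlie u y.
Proof. by rewrite /xlie !expandE; ncring. Qed.
Lemma xlieNl x u : xlie (- x) u = - xlie x u.
Proof. by rewrite /xlie !expandE; ncring. Qed.
Lemma xlie0l u : xlie 0 u = 0.
Proof. by rewrite /xlie !expandE. Qed.
Lemma xlie0r u : xlie u 0 = 0.
Proof. by rewrite /xlie !expandE. Qed.

Section Additivity.
Hypothesis Z_inj : forall x, Z x = 0 -> x = 0.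
Hypothesis Z1_inj : forall x, x - Z x = 0 -> x = 0.
Hypothesis semiprime : forall x : A, (forall y, x * y * x = 0) -> x = 0.
Hypothesis corner_faithful : forall x : A,
  (forall e s : A, e * e = e -> x * (e * s * (1 - e)) = 0) -> x = 0.
Variable phi : A -> A.
Hypothesis phi_xlie :
  forall x y, phi (xlie x y) = xlie (phi x) y + xlie x (phi y).

Definition defect x y := phi (x + y) - phi x - phi y.

Lemma phi0 : phi 0 = 0.
Proof. by have := phi_xlie 0 0; rewrite xlie0l xlie0l xlie0r addr0. Qed.

Lemma defect0l y : defect 0 y = 0.
Proof. by rewrite /defect phi0 subr0 add0r subrr. Qed.

Lemma defect0r x : defect x 0 = 0.
Proof. by rewrite /defect phi0 subr0 addr0 subrr. Qed.

(** The whole additivity argument rests on this equivariance: both sides come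
from applying the derivation identity to [xlie (x + y) u], [xlie x u] and
[xlie y u], whose second arguments agree. *)
Lemma defect_xlie x y u : defect (xlie x u) (xlie y u) = xlie (defect x y) u.
Proof.
rewrite /defect -xlieDl !phi_xlie !xlieDl !xlieNl.
by ncring.
Qed.

Section Peirce.
Variables (e f : A).
Hypotheses (ee : e * e = e) (ef : e * f = 0) (fe : f * e = 0) (ff : f * f = f).
Hypothesis e_f : e + f = 1.
Let cornerE := idempotent_rules ee ef fe ff.

Lemma peirceE x :
  x = e * (x * e) + e * (x * f) + f * (x * e) + f * (x * f).
Proof.
rewrite -[LHS]mulr1 -[LHS]mul1r -e_f !mulrDl !mulrDr.
by ncring.
Qed.

(** The diagonal component at [f] is multiplied by [1 - Z], and the off-diagonal
ones by [1] and [- Z]. *)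
Lemma xlie_idem0 d : xlie d f = 0 -> d = e * (d * e).
Proof.
move=> h.
have hff : f * (d * f) = 0.
  apply: Z1_inj; have : f * xlie d f * f = 0 by rewrite h mulr0 mul0r.
  by rewrite /xlie; expand_in cornerE.
have hef : e * (d * f) = 0.
  have : e * xlie d f = 0 by rewrite h mulr0.
  by rewrite /xlie; expand_in cornerE.
have hfe : f * (d * e) = 0.
  apply: Z_inj; have : xlie d f * e = 0 by rewrite h mul0r.
  rewrite /xlie; expand_in cornerE.
  by move/eqP; rewrite oppr_eq0 => /eqP.
by rewrite [LHS]peirceE hff hef hfe !addr0.
Qed.

(** The bracket with [f] kills [e], and the bracket with [e * t * f] kills
[e * s * f]. *)
Lemma defect_idem_corner s : let d := defect e (e * s * f) in
  d = e * (d * e) /\ forall t, d * (e * t * f) = 0.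
Proof.
move=> d.
have dE : d = e * (d * e).
  apply: xlie_idem0; rewrite -defect_xlie.
  have -> : xlie e f = 0 by rewrite /xlie ef fe raddf0 subr0.
  exact: defect0l.
split=> // t; have : xlie d (e * t * f) = 0.
  rewrite -defect_xlie [X in defect _ X](_ : _ = 0) ?defect0r//.
  by rewrite /xlie; expand_in cornerE.
by clearbody d; rewrite /xlie dE; expand_in cornerE.
Qed.
End Peirce.

Section Corner.
Variables (e f : A).
Hypotheses (ee : e * e = e) (ef : e * f = 0) (fe : f * e = 0) (ff : f * f = f).
Hypothesis e_f : e + f = 1.
Let cornerE := idempotent_rules ee ef fe ff.

(** The bracket with [e] kills [f], and the bracket with [e * t * f] kills
[e * s * f]. *)
Lemma defect_coidem_corner s : let d := defect f (e * s * f) in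
  d = f * (d * f) /\ forall t, (e * t * f) * d = 0.
Proof.
move=> d.
have dE : d = f * (d * f).
  apply: (xlie_idem0 ff fe ef ee); first by rewrite addrC.
  rewrite -defect_xlie.
  have -> : xlie f e = 0 by rewrite /xlie ef fe raddf0 subr0.
  exact: defect0l.
split=> // t; apply: Z_inj; have : xlie d (e * t * f) = 0.
  rewrite -defect_xlie [X in defect _ X](_ : _ = 0) ?defect0r//.
  by rewrite /xlie; expand_in cornerE.
rewrite /xlie; clearbody d; rewrite dE; expand_in cornerE.
by move/eqP; rewrite oppr_eq0 => /eqP.
Qed.

(** With [a = e * s * f] and [b = e * t * f] one has
[xlie (e + a) (f + b) = a + b].  Expanding [phi] of the left-hand side, the
defects of [e + a] and [f + b] contribute nothing: by the two previous lemmas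
they vanish in the bracket with [f + b] and [e + a] respectively. *)
Lemma defect_corner s t : defect (e * s * f) (e * t * f) = 0.
Proof.
have [] : _ /\ _ := defect_idem_corner ee ef fe ff e_f s.
have [] : _ /\ _ := defect_coidem_corner t.
set a := e * s * f; set b := e * t * f; set d' := defect f b.
set d := defect e a => d'E ad' dE db.
have hab : xlie (e + a) (f + b) = a + b.
  rewrite /xlie /a /b; expand_in cornerE.
  by ncring.
have eb : xlie e b = b.
  by rewrite /xlie /a /b; expand_in cornerE.
have af : xlie a f = a.
  by rewrite /xlie /a /b; expand_in cornerE.
have ef0 : xlie e f = 0 by rewrite /xlie ef fe raddf0 subr0.
have ab : xlie a b = 0.
  by rewrite /xlie /a /b; expand_in cornerE.
have phie : phi (e + a) = phi e + phi a + d.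
  by rewrite /d /defect; ncring.
have phif : phi (f + b) = phi f + phi b + d'.
  by rewrite /d' /defect; ncring.
have hd : xlie d (f + b) = 0.
  rewrite xlieDr {2}/xlie (db t) dE /xlie /b.
  by expand_in cornerE.
have hd' : xlie (e + a) d' = 0.
  rewrite xlieDl {2}/xlie (ad' s) d'E /xlie /a.
  by expand_in cornerE.
have phiab : phi (a + b) =
    xlie (phi e + phi a) (f + b) + xlie (e + a) (phi f + phi b).
  rewrite -hab phi_xlie phie phif.
  by rewrite [xlie (_ + d) _]xlieDl hd [xlie _ (_ + d')]xlieDr hd' !addr0.
have -> : defect a b = (xlie (phi e) f + xlie e (phi f))
    + (xlie (phi a) b + xlie a (phi b))
    + (xlie (phi e) b + xlie e (phi b) - phi b)
    + (xlie (phi a) f + xlie a (phi f) - phi a).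
  by rewrite /defect phiab !(xlieDl, xlieDr); ncring.
by rewrite -!phi_xlie eb af ab ef0 phi0 !subrr !addr0.
Qed.

Lemma defect_corner11 x y s : e * (defect x y * (e * (s * f))) = 0.
Proof.
set t := e * s * f.
have : xlie (xlie (xlie (xlie (defect x y) e) t) e) f = 0.
  rewrite -!defect_xlie !xlie_corner11//.
  set u := fun x => x * e * s - Z (x * e * s).
  have E v : - (Z (e * v * t - Z (e * v * t))) = e * (- Z (u v)) * f.
    by rewrite /u /t; expand_in cornerE.
  by rewrite !E defect_corner.
rewrite xlie_corner11// => /eqP; rewrite oppr_eq0 => /eqP/Z_inj/Z1_inj.
by rewrite /t -!mulrA.
Qed.

(** Let [d] be the defect.  The component [f * d * e] is not directly
accessible: brackets only move it to [e A e], where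
[defect_corner11] applies and yields [t * d * t' = 0] for [t, t'] in [e A f].
Semiprimeness removes the left factor. *)
Lemma defect_corner0 x y s : defect x y * (e * (s * f)) = 0.
Proof.
have h s' s'' : e * s' * f * defect x y * (e * s'' * f) = 0.
  have : e * xlie (xlie (xlie (xlie (defect x y) e) f) (e * s' * f)) e *
         (e * s'' * f) = 0.
    by rewrite -!defect_xlie -!mulrA defect_corner11.
  rewrite xlie_corner21// => h; apply/Z1_inj/Z_inj/Z_inj; rewrite -[RHS]h.
  by expand_in cornerE.
rewrite -[LHS]mul1r -e_f mulrDl defect_corner11 add0r.
apply: semiprime => v.
rewrite -[RHS](mulr0 (f * defect x y)) -(h (s * f * v) s).
by ncring.
Qed.
End Corner.

Theorem xlie_derivation_additive : {morph phi : x y / x + y}.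
Proof.
move=> x y; apply/eqP; rewrite -subr_eq0 opprD addrA; apply/eqP.
apply: corner_faithful => e s ee; rewrite -mulrA; apply: defect_corner0 => //.
- by rewrite mulrBr mulr1 ee subrr.
- by rewrite mulrBl mul1r ee subrr.
- by rewrite mulrBl !mulrBr !mulr1 mul1r ee subrr subr0.
- by rewrite addrC subrK.
Qed.

(** * From additivity to the Leibniz rule *)

Definition leibniz_defect x y := phi (x * y) - phi x * y - x * phi y.
Local Notation del := leibniz_defect.

Lemma leibniz_defect_cocycle x y u :
  x * del y u - del (x * y) u + del x (y * u) - del x y * u = 0.
Proof. by rewrite /del !mulrA; ncring. Qed.

Let phiD := xlie_derivation_additive.

Let phiN x : phi (- x) = - phi x.
Proof. by apply/eqP; rewrite -addr_eq0 -phiD addNr phi0. Qed.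

Lemma leibniz_defect_flip x y :
  del x y = Z (del y x) + (phi (Z (y * x)) - Z (phi (y * x))).
Proof.
have := phi_xlie x y; rewrite /xlie phiD phiN => h.
rewrite /del !expandE -[phi (x * y)](subrK (phi (Z (y * x)))) h.
by ncring.
Qed.

(** When [1 + Z] is injective, [phi 1] controls both defects, and it turns out
to vanish. *)
Section NotJordan.
Hypothesis Zp1_inj : forall x, x + Z x = 0 -> x = 0.
Let c := phi 1.
Let tau x := phi (Z x) - Z (phi x).

(* Substituting the flip identity into itself gives
   [del x y = Z (Z (del x y) + tau (x * y)) + tau (y * x)]; for [y = 1] or
   [x = 1] this says that [1 + Z] kills the difference of the two sides. *)
Let tauE x : (tau x = Z (x * c) - x * c) * (tau x = Z (c * x) - c * x).
Proof.
have del1 : (del x 1 = - (x * c)) * (del 1 x = - (c * x)).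
  by rewrite /del mulr1 !mul1r /c; split; ncring.
split; apply/eqP; rewrite -subr_eq0; apply/eqP; apply: Zp1_inj.
  have h : del x 1 = Z (Z (del x 1) + tau x) + tau x.
    rewrite {1}leibniz_defect_flip (leibniz_defect_flip 1 x).
    by rewrite !mulr1 !mul1r.
  rewrite del1.1 in h; rewrite -[RHS](subrr_eq h) !expandE.
  by ncring.
have h : del 1 x = Z (Z (del 1 x) + tau x) + tau x.
  rewrite {1}leibniz_defect_flip (leibniz_defect_flip x 1).
  by rewrite !mulr1 !mul1r.
rewrite del1.2 in h; rewrite -[RHS](subrr_eq h) !expandE.
by ncring.
Qed.

Let c_central x : c * x = x * c.
Proof.
apply/eqP; rewrite -subr_eq0; apply/eqP; apply: Z1_inj.
rewrite -[RHS](subrr (tau x)) {1}(tauE x).1 (tauE x).2 !expandE.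
by ncring.
Qed.

Let delE x y : del x y + Z (del x y) = - (c * (Z (x * y) + y * x)).
Proof.
apply/eqP; rewrite -subr_eq0; apply/eqP; apply: Z1_inj.
have h : del x y = Z (Z (del x y) + tau (x * y)) + tau (y * x).
  by rewrite {1}leibniz_defect_flip (leibniz_defect_flip y x).
rewrite !(tauE _).2 in h; rewrite -[RHS](subrr_eq (esym h)) !expandE.
by ncring.
Qed.

(* This is the cocycle identity for [del + Z \o del], which [delE] computes: the
   terms in [Z] cancel and the others form a double commutator. *)
Let c_commutator2 x u y : c * (x * u - u * x) * y = y * (c * (x * u - u * x)).
Proof.
have h : x * (del y u + Z (del y u)) - (del (x * y) u + Z (del (x * y) u))
    + (del x (y * u) + Z (del x (y * u))) - (del x y + Z (del x y)) * u = 0.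
  have h := leibniz_defect_cocycle x y u.
  rewrite -[RHS](addr0 0) -{1}h -[in RHS](raddf0 Z) -h !expandE.
  by ncring.
rewrite !delE in h.
apply/eqP; rewrite -subr_eq0; apply/eqP; rewrite -[RHS]oppr0 -h !expandE.
rewrite ![_ * (c * _)]mulrA -!c_central -!mulrA.
by ncring.
Qed.

(* Centrality of [c * (x * y - y * x)] for the pair [(x, x * y)] gives
   [(x * v - v * x) * u = 0], where [u] is the left-hand side; hence [u], which
   is central, squares to zero. *)
Let c_commutator x y : c * (x * y - y * x) = 0.
Proof.
set u := c * _.
have uC v : u * v = v * u by exact: c_commutator2.
have xu v : (x * v - v * x) * u = 0.
  have := c_commutator2 x (x * y) v.
  have -> : c * (x * (x * y) - x * y * x) = x * u.
    by rewrite /u [in RHS]mulrA -c_central; ncring.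
  rewrite -mulrA uC => /eqP; rewrite -subr_eq0 => /eqP <-.
  by ncring.
apply: semiprime => v; rewrite uC -mulrA.
by rewrite {1}/u -mulrA xu !mulr0.
Qed.

Let c_eq0 : c = 0.
Proof.
apply: corner_faithful => e s ee.
by rewrite -corner_commutator ?c_commutator.
Qed.

Lemma leibniz_not_jordan :
  (forall x y, del x y = 0) /\ forall x, phi (Z x) = Z (phi x).
Proof.
split=> [x y|x].
  by apply: Zp1_inj; rewrite delE c_eq0 mul0r oppr0.
apply/eqP; rewrite -subr_eq0; apply/eqP.
by rewrite -/(tau x) (tauE x).2 c_eq0 mul0r raddf0 subrr.
Qed.
End NotJordan.

(** When [Z = -1], the map [phi] is an additive Jordan derivation. *)
Section Jordan.
Hypothesis ZN : forall x, Z x = - x.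

Let two_inj (x : A) : x + x = 0 -> x = 0.
Proof. by move=> h; apply: Z1_inj; rewrite ZN opprK. Qed.

Lemma jordan_mul x y :
  phi (x * y + y * x) = phi x * y + y * phi x + (x * phi y + phi y * x).
Proof. by have := phi_xlie x y; rewrite /xlie !ZN !opprK. Qed.

(** [2 x y x] is the Jordan product of [x] with [x y + y x] minus that of
[x ^ 2] with [y]. *)
Lemma jordan_triple x y :
  phi (x * y * x) = phi x * y * x + x * phi y * x + x * y * phi x.
Proof.
have sq : phi (x * x) = phi x * x + x * phi x.
  apply/eqP; rewrite -subr_eq0; apply/eqP; apply: two_inj.
  rewrite -[RHS](subrr_eq (esym (jordan_mul x x))) phiD.
  by ncring.
apply/eqP; rewrite -subr_eq0; apply/eqP; apply: two_inj.
have h1 := jordan_mul x (x * y + y * x).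
rewrite [phi (x * y + y * x)]jordan_mul in h1.
have h2 := jordan_mul (x * x) y; rewrite sq in h2.
have h3 : phi (x * y * x) + phi (x * y * x) + phi (x * x * y + y * (x * x)) =
          phi (x * (x * y + y * x) + (x * y + y * x) * x).
  by rewrite -!phiD; congr phi; ncring.
rewrite h2 h1 in h3; rewrite -[RHS](subrr_eq (esym h3)).
by ncring.
Qed.

Lemma jordan_triple2 x y u :
  phi (x * y * u + u * y * x) = phi x * y * u + x * phi y * u + x * y * phi u
    + (phi u * y * x + u * phi y * x + u * y * phi x).
Proof.
have h : phi ((x + u) * y * (x + u)) =
    phi (x * y * x) + phi (x * y * u + u * y * x) + phi (u * y * u).
  by rewrite -!phiD; congr phi; ncring.
rewrite !jordan_triple phiD in h.
apply/eqP; rewrite -subr_eq0; apply/eqP; rewrite -[RHS](subrr_eq h).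
by ncring.
Qed.

Let delC x y : del y x = - del x y.
Proof. by rewrite (leibniz_defect_flip y x) !ZN phiN subrr addr0. Qed.

(** The element [x y u y x + y x u x y] can be differentiated both as a
linearized triple product of [x y], [u], [y x] and as a sum of two iterated
triple products; the two results differ by the left-hand side. *)
Lemma leibniz_defect_commutator x y u :
  del x y * u * (x * y - y * x) + (x * y - y * x) * u * del x y = 0.
Proof.
have h : phi (x * y * u * (y * x) + y * x * u * (x * y)) =
    phi (x * (y * u * y) * x) + phi (y * (x * u * x) * y).
  by rewrite -phiD; congr phi; ncring.
rewrite jordan_triple2 !jordan_triple in h.
have yx : phi (y * x) = phi y * x + y * phi x - del x y.
  by rewrite -delC /del; ncring.
have xy : phi (x * y) = phi x * y + x * phi y + del x y.
  by rewrite /del; ncring.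
rewrite xy yx in h; rewrite -[RHS](subrr_eq h).
by ncring.
Qed.

(* Moving [a] across [b] with a sign, [a u b v a u b] becomes [- a u a v b u b]
   by one exchange and [a u a v b u b] by four. *)
Let anticommute_zero a b : (forall u, a * u * b + b * u * a = 0) ->
  forall u : A, a * u * b = 0.
Proof.
move=> ab; have swap u : a * u * b = - (b * u * a).
  by apply/eqP; rewrite -addr_eq0; apply/eqP.
move=> u; apply: semiprime => v; apply: two_inj.
have k1 : a * u * b * v * (a * u * b) = - (a * u * a * v * (b * u * b)).
  transitivity (a * u * (b * v * a) * (u * b)); first by ncring.
  by rewrite -[b * v * a]opprK -swap; ncring.
have k2 : a * u * b * v * (a * u * b) = a * u * a * v * (b * u * b).
  transitivity (- (b * u * (a * (v * a * u) * b))).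
    by rewrite {1}swap; ncring.
  rewrite swap; transitivity (b * (u * b * v) * a * (u * a)).
    by ncring.
  rewrite -[b * (u * b * v) * a]opprK -swap.
  transitivity (- (a * u * (b * (v * b * u) * a))).
    by ncring.
  rewrite -[b * (v * b * u) * a]opprK -swap.
  by ncring.
by rewrite {1}k1 k2 addNr.
Qed.

Let delDl x x' y : del (x + x') y = del x y + del x' y.
Proof. by rewrite /del mulrDl !phiD; ncring. Qed.

Let delDr x y y' : del x (y + y') = del x y + del x y'.
Proof. by rewrite /del mulrDr !phiD; ncring. Qed.

Let del_commutator x y u : del x y * u * (x * y - y * x) = 0.
Proof.
exact: anticommute_zero (leibniz_defect_commutator x y) u.
Qed.

Let zero_flip a b : (forall u, a * u * b = 0) -> forall u : A, b * u * a = 0.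
Proof.
move=> ab u; apply: semiprime => v.
transitivity (b * u * (a * v * b) * (u * a)); first by ncring.
by rewrite ab mulr0 mul0r.
Qed.

(* Linearizing [del_commutator] in [y] exchanges [y] and [y'] up to sign;
   inserting this in [a v a], where [a] is the left-hand side, produces a factor
   [(x * y' - y' * x) * v * del x y'], which is zero. *)
Let del_commutator_r x y y' u : del x y * u * (x * y' - y' * x) = 0.
Proof.
have h v : del x y * v * (x * y' - y' * x) =
    - (del x y' * v * (x * y - y * x)).
  apply/eqP; rewrite -addr_eq0; apply/eqP.
  rewrite -[RHS](del_commutator x (y + y') v) delDr.
  rewrite -[LHS]addr0 -{1}(del_commutator x y v) -[LHS]addr0.
  by rewrite -{1}(del_commutator x y' v); ncring.
apply: semiprime => v; rewrite {2}h.
transitivity (- (del x y * u * ((x * y' - y' * x) * v * del x y')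
                 * (u * (x * y - y * x)))); first by ncring.
by rewrite (zero_flip (del_commutator x y')) mulr0 mul0r oppr0.
Qed.

Lemma jordan_leibniz x y : del x y = 0.
Proof.
apply: corner_faithful => e s ee.
have h1 x' y' u : del x y * u * (x' * y' - y' * x') =
    - (del x' y * u * (x * y' - y' * x)).
  apply/eqP; rewrite -addr_eq0; apply/eqP.
  rewrite -[RHS](del_commutator_r (x + x') y y' u) delDl.
  rewrite -[LHS]addr0 -{1}(del_commutator_r x y y' u) -[LHS]addr0.
  by rewrite -{1}(del_commutator_r x' y y' u); ncring.
have h2 x' y' : del x y * (x' * y' - y' * x') = 0.
  suff h u : del x y * u * (x' * y' - y' * x') = 0.
    by have := h 1; rewrite mulr1.
  apply: semiprime => v; rewrite {2}h1.
  transitivity (- (del x y * u * ((x' * y' - y' * x') * v * del x' y)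
                   * (u * (x * y' - y' * x)))); first by ncring.
  by rewrite (zero_flip (del_commutator_r x' y y')) mulr0 mul0r oppr0.
by rewrite -corner_commutator ?h2.
Qed.
End Jordan.

Theorem xlie_derivation_leibniz :
    (forall x, Z x = - x) \/ (forall x, x + Z x = 0 -> x = 0) ->
  (forall x y, phi (x * y) = phi x * y + x * phi y) /\
  forall x, phi (Z x) = Z (phi x).
Proof.
case=> [ZN|/leibniz_not_jordan[h1 h2]]; split=> // x; rewrite ?ZN ?phiN//;
  move=> y; apply/eqP; rewrite -subr_eq0 opprD addrA; apply/eqP.
- exact: jordan_leibniz.
- exact: h1.
Qed.
End Additivity.
End CentroidBracket.

(** * Operators and their adjoints *)

Section OperatorEval.
Variables (K : numFieldType) (H : normedModType K).
Implicit Types (S T : bounded_operator H) (x : H).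

Lemma opDE S T x : (S + T) x = S x + T x. Proof. by []. Qed.
Lemma opNE T x : (- T) x = - T x. Proof. by []. Qed.
Lemma opZE a T x : (a *: T) x = a *: T x. Proof. by []. Qed.
Lemma op0E x : (0 : bounded_operator H) x = 0. Proof. by []. Qed.
Lemma opME S T x : (S * T) x = S (T x). Proof. by []. Qed.
Lemma op1E x : (1 : bounded_operator H) x = x. Proof. by []. Qed.
Definition opE := (opDE, opNE, opZE, op0E, opME, op1E).

Lemma op_ext S T : (forall x, S x = T x) -> S = T.
Proof. by move=> ST; apply/val_inj/funext. Qed.

Lemma op_linD T x y : T (x + y) = T x + T y.
Proof. by have := operator_linear T 1 x y; rewrite !scale1r. Qed.
Lemma op_lin0 T : T 0 = 0.
Proof. by apply: (@addrI _ (T 0)); rewrite -op_linD !addr0. Qed.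
Lemma op_linZ T a x : T (a *: x) = a *: T x.
Proof. by have := operator_linear T a x 0; rewrite op_lin0 !addr0. Qed.
Lemma op_linN T x : T (- x) = - T x.
Proof. by rewrite -scaleN1r op_linZ scaleN1r. Qed.

Lemma op_scalerAl a S T : (a *: S) * T = a *: (S * T).
Proof. exact: op_ext. Qed.
Lemma op_scalerAr a S T : S * (a *: T) = a *: (S * T).
Proof. by apply: op_ext => x; rewrite !opE op_linZ. Qed.
End OperatorEval.

Section Hilbert.
Variables (R : realType) (H : completeNormedModType R[i]).
Variable dot : {dot H for (@Num.conj R[i])}.
Hypothesis norm_dot : forall x : H, `|x| ^+ 2 = dot x x.
Local Notation K := R[i].
Local Notation B := (bounded_operator H).
Implicit Types (S T X Y : B) (x y : H).

Lemma dotC x y : dot y x = (dot x y)^*.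
Proof. by rewrite hermC expr0 mul1r. Qed.
Lemma dotDl x y z : dot (x + y) z = dot x z + dot y z.
Proof. exact: linearDl. Qed.
Lemma dotDr x y z : dot z (x + y) = dot z x + dot z y.
Proof. exact: linearDr. Qed.
Lemma dotNl x z : dot (- x) z = - dot x z.
Proof. exact: linearNl. Qed.
Lemma dotNr x z : dot z (- x) = - dot z x.
Proof. exact: linearNr. Qed.
Lemma dotZl a x z : dot (a *: x) z = a * dot x z.
Proof. exact: linearZl_LR. Qed.
Lemma dotZr a x z : dot z (a *: x) = a^* * dot z x.
Proof. exact: linearZr_LR. Qed.
Lemma dot0r z : dot z 0 = 0. Proof. exact: linear0r. Qed.

Lemma dot_ext x y : (forall z, dot x z = dot y z) -> x = y.
Proof.
move=> xy; apply/eqP; rewrite -subr_eq0 -(dnorm_eq0 dot); apply/eqP.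
by rewrite dotDl dotNl xy subrr.
Qed.

(** The square of the norm of [dot y y *: x - dot x y *: y] is nonnegative. *)
Lemma dot_cauchy_schwarz x y : `|dot x y| <= `|x| * `|y|.
Proof.
have [->|y0] := eqVneq y 0; first by rewrite dot0r !normr0 mulr0.
rewrite -(@ler_pXn2r _ 2)// ?nnegrE// ?mulr_ge0// exprMn !norm_dot.
have yy : 0 < dot y y by rewrite dnorm_gt0.
have := dnorm_ge0 dot (dot y y *: x - dot x y *: y).
rewrite dotDl !dotDr !dotNl !dotNr !dotZl !dotZr opprK.
rewrite (geC0_conj (ltW yy)) -(dotC x y) => h.
suff : 0 <= dot y y * (dot x x * dot y y - `|dot x y| ^+ 2).
  by rewrite pmulr_rge0// subr_ge0.
rewrite normCK -(dotC x y) (le_trans h)// le_eqVlt; apply/orP; left.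
by apply/eqP; ring.
Qed.

Lemma adjointC T S : is_adjoint dot T S -> is_adjoint dot S T.
Proof. by move=> TS x y; rewrite dotC -TS -dotC. Qed.

Lemma adjointD T S T' S' : is_adjoint dot T S -> is_adjoint dot T' S' ->
  is_adjoint dot (T + T') (S + S').
Proof. by move=> h h' x y; rewrite !opE dotDl dotDr h h'. Qed.

Lemma adjointN T S : is_adjoint dot T S -> is_adjoint dot (- T) (- S).
Proof. by move=> h x y; rewrite !opE dotNl dotNr h. Qed.

Lemma adjointZ a T S : is_adjoint dot T S -> is_adjoint dot (a *: T) (a^* *: S).
Proof. by move=> h x y; rewrite !opE dotZl dotZr conjCK h. Qed.

Lemma adjointM T S T' S' : is_adjoint dot T S -> is_adjoint dot T' S' ->
  is_adjoint dot (T * T') (S' * S).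
Proof. by move=> h h' x y; rewrite !opE h h'. Qed.

Lemma adjoint1 : is_adjoint dot 1 1. Proof. by []. Qed.

Lemma adjoint_inj T S S' : is_adjoint dot T S -> is_adjoint dot T S' -> S = S'.
Proof.
move=> h h'; apply: op_ext => x; apply: dot_ext => z.
by rewrite (adjointC h) (adjointC h').
Qed.

Definition pos T := forall x, 0 <= dot (T x) x.

Lemma posD S T : pos S -> pos T -> pos (S + T).
Proof. by move=> hS hT x; rewrite opE dotDl addr_ge0. Qed.

Lemma posZ a T : 0 <= a -> pos T -> pos (a *: T).
Proof. by move=> a0 hT x; rewrite opE dotZl mulr_ge0. Qed.

Lemma pos_sqr T S : is_adjoint dot T S -> pos (S * T).
Proof. by move=> h x; rewrite opE (adjointC h) dnorm_ge0. Qed.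

Lemma pos_conj X T : is_adjoint dot X X -> pos T -> pos (X * T * X).
Proof. by move=> h hT x; rewrite !opE h. Qed.

(** * The Newton iteration for the sign of a self-adjoint contraction *)

(** The polynomials in [D] with nonnegative coefficients.  They are positive
whenever [D] is, whereas positivity of general products of commuting positive
operators would require square roots. *)
Inductive cone (D : B) : B -> Prop :=
| cone1 : cone D 1
| coneM1 Z : cone D Z -> cone D (D * Z)
| coneD Z Z' : cone D Z -> cone D Z' -> cone D (Z + Z')
| coneZ a Z : 0 <= a -> cone D Z -> cone D (a *: Z).

Lemma cone_self D : cone D D.
Proof. by rewrite -[X in cone D X]mulr1; apply/coneM1/cone1. Qed.

Lemma coneM D Z Z' : cone D Z -> cone D Z' -> cone D (Z * Z').
Proof.
move=> hZ hZ'; elim: hZ => [|Z1 _ ih|Z1 Z2 _ h1 _ h2|a Z1 a0 _ ih].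
- by rewrite mul1r.
- by rewrite -mulrA; apply: coneM1.
- by rewrite mulrDl; apply: coneD.
- by rewrite op_scalerAl; apply: coneZ.
Qed.

Lemma cone_trans D D' Z : cone D D' -> cone D' Z -> cone D Z.
Proof.
move=> h; elim=> [|Z1 _ ih|Z1 Z2 _ h1 _ h2|a Z1 a0 _ ih].
- exact: cone1.
- exact: coneM.
- exact: coneD.
- exact: coneZ.
Qed.

Lemma cone_comm D Z X : X * D = D * X -> cone D Z -> X * Z = Z * X.
Proof.
move=> h; elim=> [|Z1 _ ih|Z1 Z2 _ h1 _ h2|a Z1 a0 _ ih].
- by rewrite mulr1 mul1r.
- by rewrite mulrA h -mulrA ih mulrA.
- by rewrite mulrDl mulrDr h1 h2.
- by rewrite op_scalerAl op_scalerAr ih.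
Qed.

(** Each power of [D] is [D ^ k * D ^ k] or [D ^ k * D * D ^ k]. *)
Lemma cone_pos D Z : is_adjoint dot D D -> pos D -> cone D Z -> pos Z.
Proof.
move=> aD pD hZ.
have saX k : is_adjoint dot (D ^+ k) (D ^+ k).
  elim: k => [|k ih]; first exact: adjoint1.
  by rewrite {1}exprS exprSr; apply: adjointM.
have pX k : pos (D ^+ k).
  rewrite -(odd_double_half k) -addnn; case: odd; rewrite !exprD.
    by rewrite expr1 mulrA -exprS exprSr; apply: pos_conj.
  by rewrite mul1r; apply: pos_sqr.
suff h k : pos (D ^+ k * Z) by have := h 0; rewrite expr0 mul1r.
elim: hZ k => [|Z1 _ ih|Z1 Z2 _ h1 _ h2|a Z1 a0 _ ih] k.
- by rewrite mulr1.
- by rewrite mulrA -exprSr.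
- by rewrite mulrDr; apply: posD.
- by rewrite op_scalerAr; apply: posZ.
Qed.

(** With [E = (1 - X ^ 2) / 2], the condition that [E] is positive says that a
self-adjoint [X] is a contraction, and the Newton step is [X (1 + E)]. *)
Definition half_gap X : B := 2^-1 *: (1 - X * X).
Definition newton X : B := X * (1 + half_gap X).

Lemma halfD : 2^-1 + 2^-1 = 1 :> K.
Proof. by rewrite -[2^-1]mul1r -splitr. Qed.

Lemma half_gapE X : half_gap X + half_gap X = 1 - X * X.
Proof. by rewrite -scalerDl halfD scale1r. Qed.

Lemma half_gap_comm X Y : X * Y = Y * X -> half_gap X * Y = Y * half_gap X.
Proof.
move=> h; rewrite /half_gap op_scalerAl op_scalerAr; congr (_ *: _).
by rewrite mulrBl mulrBr mul1r mulr1 -mulrA h !mulrA h.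
Qed.

(** The new gap is a polynomial with nonnegative coefficients in the old one.
This keeps the iterates contractive and makes their squares increase. *)
Lemma half_gap_newton X : let E := half_gap X in
  half_gap (newton X) = 2^-1 *: (E * E + E * E + E * E) + E * E * E.
Proof.
move=> E; rewrite {1}/half_gap /newton -/E.
have XE : X * E = E * X by rewrite half_gap_comm.
have XX : X * X = 1 - (E + E) by rewrite half_gapE opprB addrC subrK.
have -> : X * (1 + E) * (X * (1 + E)) = X * X * ((1 + E) * (1 + E)).
  rewrite !mulrA; congr (_ * _); rewrite -!mulrA; congr (_ * _).
  by rewrite mulrDl mulrDr mulr1 mul1r XE.
have -> : 1 - X * X * ((1 + E) * (1 + E)) =
          (E * E + E * E + E * E) + (E * E * E + E * E * E).
  by rewrite XX; ncring.
rewrite scalerDr; congr (_ + _).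
by rewrite scalerDr -scalerDl halfD scale1r.
Qed.

Lemma cone_half_gap_newton X : cone (half_gap X) (half_gap (newton X)).
Proof.
rewrite half_gap_newton.
have c := @cone_self (half_gap X).
apply: coneD; last by apply: coneM => //; apply: coneM.
by apply: coneZ => //; do 2?apply: coneD; apply: coneM.
Qed.

Lemma half_gap_adjoint X :
  is_adjoint dot X X -> is_adjoint dot (half_gap X) (half_gap X).
Proof.
move=> h; rewrite /half_gap -{2}(@geC0_conj _ 2^-1)//.
by apply/adjointZ/adjointD => //; apply/adjointN/adjointM.
Qed.

Definition newton_seq A n := iter n newton A.

Section NewtonSeq.
Variable A : B.
Hypothesis A_adj : is_adjoint dot A A.
Hypothesis A_gap : pos (half_gap A).

Lemma newton_seq_cone n : cone (half_gap A) (half_gap (newton_seq A n)).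
Proof.
elim: n => [|n ih]; first exact: cone_self.
exact: cone_trans (cone_half_gap_newton _).
Qed.

Lemma newton_seqE n :
  exists2 Z, cone (half_gap A) Z & newton_seq A n = A * (1 + Z).
Proof.
elim: n => [|n [Z hZ ih]].
  by exists 0; rewrite ?addr0 ?mulr1// -(scale0r (1 : B)); apply/coneZ/cone1.
rewrite /= -/(newton_seq A n) {1}/newton {1}ih.
have c := newton_seq_cone n.
exists (Z + half_gap (newton_seq A n) + Z * half_gap (newton_seq A n)).
  by apply: coneD; [apply: coneD|apply: coneM].
by ncring.
Qed.

Lemma newton_seq_comm n Y :
  A * Y = Y * A -> newton_seq A n * Y = Y * newton_seq A n.
Proof.
move=> AY; have [Z hZ ->] := newton_seqE n.
have ZY : Y * Z = Z * Y by apply: cone_comm hZ; rewrite half_gap_comm.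
have ZY1 : (1 + Z) * Y = Y * (1 + Z) by rewrite mulrDl mulrDr mul1r mulr1 ZY.
by rewrite -mulrA ZY1 !mulrA AY.
Qed.

Lemma cone_adjoint D Z : is_adjoint dot D D -> cone D Z -> is_adjoint dot Z Z.
Proof.
move=> h; elim=> [|Z1 hZ ih|Z1 Z2 _ h1 _ h2|a Z1 a0 _ ih].
- exact: adjoint1.
- by have := adjointM h ih; rewrite -(cone_comm (erefl (D * D)) hZ).
- exact: adjointD.
- by rewrite -{2}(geC0_conj a0); apply: adjointZ.
Qed.

Lemma newton_seq_adjoint n : is_adjoint dot (newton_seq A n) (newton_seq A n).
Proof.
have [Z hZ ->] := newton_seqE n.
have ZA : A * Z = Z * A by apply: cone_comm hZ; rewrite half_gap_comm.
have -> : is_adjoint dot (A * (1 + Z)) = is_adjoint dot ((1 + Z) * A).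
  by rewrite mulrDr mulrDl mulr1 mul1r ZA.
apply: adjointM => //; apply: adjointD; first exact: adjoint1.
by apply: cone_adjoint hZ; apply: half_gap_adjoint.
Qed.

Lemma newton_seq_gap n : pos (half_gap (newton_seq A n)).
Proof.
apply: cone_pos (newton_seq_cone n) => //; exact: half_gap_adjoint.
Qed.

Lemma gap_le x : `|A x| <= `|x|.
Proof.
rewrite -(@ler_pXn2r _ 2)// ?nnegrE// !norm_dot -subr_ge0.
have := posD A_gap A_gap x; rewrite half_gapE.
by rewrite !opE dotDl dotNl A_adj.
Qed.

(** Write the iterate as [A (1 + Z)] with [Z] in the cone, [u = A x] and
[v = Z u].  The inequality reads [|v| ^ 2 <= |u + v| ^ 2 - |u| ^ 2], and the
cross terms are nonnegative as [Z] is positive. *)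
Lemma newton_seq_dist n x :
  `|newton_seq A n x - A x| ^+ 2 <= `|newton_seq A n x| ^+ 2 - `|A x| ^+ 2.
Proof.
have [Z hZ ->] := newton_seqE n.
have ZA : A * Z = Z * A by apply: cone_comm hZ; rewrite half_gap_comm.
rewrite mulrDr mulr1 ZA !opE.
set u := A x; set v := Z u; rewrite addrAC subrr add0r.
have vu : 0 <= dot v u.
  by apply: (cone_pos _ _ hZ) => //; exact: half_gap_adjoint.
rewrite !norm_dot dotDl !dotDr (dotC v u) geC0_conj//.
rewrite -subr_ge0 [X in 0 <= X](_ : _ = dot v u + dot v u) ?addr_ge0//.
by ring.
Qed.

Lemma newton_seq_pos n : pos (newton_seq A n * A).
Proof.
have [Z hZ ->] := newton_seqE n; apply: pos_conj => //; apply: posD.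
  by rewrite -[1]mulr1; apply: pos_sqr adjoint1.
apply: (cone_pos _ _ hZ) => //; exact: half_gap_adjoint.
Qed.

Lemma newton_seq_ker n x : A x = 0 -> newton_seq A n x = 0.
Proof.
move=> Ax; have [Z hZ ->] := newton_seqE n.
have ZA : A * Z = Z * A by apply: cone_comm hZ; rewrite half_gap_comm.
by rewrite mulrDr mulr1 ZA !opE Ax op_lin0 addr0.
Qed.
End NewtonSeq.

Lemma newton_seqD A m n : newton_seq A (m + n) = newton_seq (newton_seq A n) m.
Proof. by rewrite /newton_seq iterD. Qed.
End Hilbert.

(** * Strong limits and the sign operator *)

(** In a field that is only partially ordered the nonnegative elements are the
fixed points of the norm, which is continuous. *)
Lemma cvg_ge0 (K : numFieldType) (u : nat -> K) (l : K) :
  u @ \oo --> l -> (forall n, 0 <= u n) -> 0 <= l.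
Proof.
move=> ul u0; have h : `|u n| @[n --> \oo] --> `|l| by exact: cvg_norm.
have uE : (fun n => `|u n|) = u by apply/funext => n; rewrite ger0_norm.
rewrite uE in h.
have -> : l = `|l| by apply: cvg_unique ul h; exact: norm_hausdorff.
exact: normr_ge0.
Qed.

Section Limits.
Variables (R : realType) (H : completeNormedModType R[i]).
Variable dot : {dot H for (@Num.conj R[i])}.
Hypothesis norm_dot : forall x : H, `|x| ^+ 2 = dot x x.
Local Notation K := R[i].
Local Notation B := (bounded_operator H).
Implicit Types (S T X Y : B) (x y : H).

Lemma cvg_dotl (u : nat -> H) x y :
  u @ \oo --> x -> (fun n => dot (u n) y : K^o) @ \oo --> (dot x y : K^o).
Proof.
move=> /cvgrPdist_lt ux; apply/cvgrPdist_lt => e e0.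
have d0 : 0 < e / (`|y| + 1) by rewrite divr_gt0// ltr_wpDl.
near=> n; rewrite -dotNl -dotDl.
rewrite (le_lt_trans (dot_cauchy_schwarz norm_dot _ _))//.
have h : `|x - u n| < e / (`|y| + 1) by near: n; exact: ux.
rewrite (@le_lt_trans _ _ (`|x - u n| * (`|y| + 1)))//.
  by rewrite ler_wpM2l// lerDl.
by rewrite -ltr_pdivlMr// ltr_wpDl.
Unshelve. all: by end_near. Qed.

Lemma cvg_contraction (T_ : nat -> B) S (u : nat -> H) x :
  (forall n y, `|T_ n y| <= `|y|) -> (fun n => T_ n x) @ \oo --> S x ->
  u @ \oo --> x -> (fun n => T_ n (u n)) @ \oo --> S x.
Proof.
move=> T1 /cvgrPdist_lt Tx /cvgrPdist_lt ux; apply/cvgrPdist_lt => e e0.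
near=> n.
have -> : S x - T_ n (u n) = (S x - T_ n x) + T_ n (x - u n).
  by rewrite op_linD op_linN addrA subrK.
rewrite (le_lt_trans (ler_normD _ _))// (splitr e) ltrD//.
  by near: n; apply: Tx; rewrite divr_gt0.
rewrite (le_lt_trans (T1 _ _))//.
by near: n; apply: ux; rewrite divr_gt0.
Unshelve. all: by end_near. Qed.

(** The bounds [a n] lie in the real line and increase, so they converge, and
the squared distances are dominated by their increments. *)
Lemma cvg_of_dist_monotone (u : nat -> H) (a : nat -> K) (c : K) :
  (forall n, 0 <= a n <= c) ->
  (forall m n, `|u (m + n)%N - u n| ^+ 2 <= a (m + n)%N - a n) ->
  cvg (u @ \oo).
Proof.
move=> ac ua; pose b n := complex.Re (a n).
have aE n : a n = (b n)%:C%C.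
  by rewrite RRe_real// ger0_real//; case/andP: (ac n).
have cE : c = (complex.Re c)%:C%C.
  rewrite RRe_real// ger0_real//.
  by have /andP[/le_trans] := ac 0; apply.
have b_nd : nondecreasing_seq b.
  move=> n m nm; rewrite -subr_ge0 -lecR rmorphB/= -!aE.
  by rewrite -{1}(subnK nm) (le_trans _ (ua _ _))// exprn_ge0.
have /cvg_ex[l bl] : cvg (b @ \oo).
  apply: nondecreasing_is_cvgn => //; exists (complex.Re c) => _ [n _ <-].
  by rewrite -lecR -aE -cE; case/andP: (ac n).
have b_le n : b n <= l.
  by have := nondecreasing_cvgn_le b_nd (cvgP _ bl) n; rewrite (cvg_lim _ bl).
apply/cauchy_cvgP/cauchy_exP => e e0.
have eE : e = (complex.Re e)%:C%C by rewrite RRe_real// gtr0_real.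
have r0 : 0 < complex.Re e by rewrite -ltcR -eE.
have /cvgrPdist_lt/(_ _ (exprn_gt0 2 r0))[N _ hN] := bl.
exists (u N), N => // n /= Nn; rewrite -ball_normE/= -normrN opprB.
rewrite -(@ltr_pXn2r _ 2)// ?nnegrE// ?ltW//.
rewrite -{1}(subnK Nn) (le_lt_trans (ua _ _))// subnK// !aE -rmorphB/=.
rewrite eE -rmorphXn/= ltcR (le_lt_trans (lerB (b_le n) (lexx _)))//.
by apply: le_lt_trans (hN N _) => //=; exact: ler_norm.
Qed.

Lemma cvg_dotr (u : nat -> H) x y :
  u @ \oo --> x -> (fun n => dot y (u n) : K^o) @ \oo --> (dot y x : K^o).
Proof.
move=> /cvgrPdist_lt ux; apply/cvgrPdist_lt => e e0.
have d0 : 0 < e / (`|y| + 1) by rewrite divr_gt0// ltr_wpDl.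
near=> n; rewrite -dotNr -dotDr.
rewrite (le_lt_trans (dot_cauchy_schwarz norm_dot _ _))//.
have h : `|x - u n| < e / (`|y| + 1) by near: n; exact: ux.
rewrite (@le_lt_trans _ _ ((`|y| + 1) * `|x - u n|))//.
  by rewrite ler_wpM2r// lerDl.
by rewrite mulrC -ltr_pdivlMr// ltr_wpDl.
Unshelve. all: by end_near. Qed.

Lemma wot_closed (M : set B) (T_ : nat -> B) S :
  closed (M : set (weak_operator_topology dot)) ->
  (forall n, M (T_ n)) -> (forall x, T_ n x @[n --> \oo] --> S x) -> M S.
Proof.
move=> Mcl MT TS.
apply: (@closed_cvg nat (weak_operator_topology dot) \oo _ T_ M Mcl).
  exact: nearW.
pose F T : {ptws H * H -> R[i]^o} := fun xy => dot (T xy.1) xy.2.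
have FT : (F \o T_) @ \oo --> F S.
  apply/(@pointwise_cvgP (H * H)%type R[i]^o ((F \o T_) @ \oo) (F S)).
  by move=> -[x y]; exact: cvg_dotl.
move=> U /=; rewrite nbhsE => -[V [[W Wo WV] VS] VU].
have WS : nbhs (F S) W.
  by rewrite nbhsE; exists W => //; split=> //; rewrite -WV in VS.
have [N _ hN] := FT W WS; exists N => // n Nn; apply: VU; rewrite -WV.
exact: hN.
Qed.

Section NewtonLimit.
Variable A : B.
Hypothesis A_adj : is_adjoint dot A A.
Hypothesis A_gap : pos dot (half_gap A).
Local Notation X := (newton_seq A).

Lemma newton_seq_le n x : `|X n x| <= `|x|.
Proof.
apply: (gap_le norm_dot); first exact: newton_seq_adjoint.
exact: newton_seq_gap.
Qed.

Lemma newton_seq_cvg x : cvg (X n x @[n --> \oo]).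
Proof.
apply: (@cvg_of_dist_monotone _ (fun n => `|X n x| ^+ 2) (`|x| ^+ 2)).
  by move=> n; rewrite exprn_ge0//= ler_pXn2r ?nnegrE// newton_seq_le.
move=> m n /=; rewrite newton_seqD; apply: newton_seq_dist => //.
  exact: newton_seq_adjoint.
exact: newton_seq_gap.
Qed.

Definition newton_lim x : H := lim (X n x @[n --> \oo]).

Lemma cvg_newton_lim x : X n x @[n --> \oo] --> newton_lim x.
Proof. exact: newton_seq_cvg. Qed.

Lemma newton_lim_bounded : newton_lim \in @bounded_linear K H.
Proof.
apply/bounded_linearP; split.
  move=> a x y; apply: cvg_lim; first exact: norm_hausdorff.
  have -> : (fun n => X n (a *: x + y)) = (fun n => a *: X n x + X n y).
    by apply/funext => n; exact: operator_linear.
  apply: cvgD; last exact: cvg_newton_lim.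
  by apply: cvgZl_tmp; exact: cvg_newton_lim.
exists 1 => // x; rewrite mul1r -subr_ge0.
apply: (@cvg_ge0 K (fun n => `|x| - `|X n x|)).
  by apply: cvgB; [exact: cvg_cst|apply: cvg_norm; exact: cvg_newton_lim].
by move=> n; rewrite subr_ge0 newton_seq_le.
Qed.

Definition newton_sign : B := BoundedOperator newton_lim_bounded.
Local Notation S := newton_sign.

Lemma cvg_newton_sign x : X n x @[n --> \oo] --> S x.
Proof. exact: cvg_newton_lim. Qed.

Lemma newton_sign_adjoint : is_adjoint dot S S.
Proof.
move=> x y; have h1 := cvg_dotl (y := y) (@cvg_newton_sign x).
have h2 := cvg_dotr (y := x) (@cvg_newton_sign y).
apply: (cvg_unique _ h1); first exact: norm_hausdorff.
rewrite [X in X @ _](_ : _ = (fun n => dot x (X n y) : K^o))//.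
by apply/funext => n; exact: newton_seq_adjoint.
Qed.

(** Passing to the limit in [X_(n+1) x = X_n (x + (x - X_n (X_n x)) / 2)]. *)
Lemma newton_sign_cube : S * S * S = S.
Proof.
apply: op_ext => x; rewrite !opE.
have h1 := @cvg_newton_sign x.
have h2 : X n (X n x) @[n --> \oo] --> S (S x).
  apply: cvg_contraction => //; first exact: newton_seq_le.
  exact: cvg_newton_sign.
have h3 : X n.+1 x @[n --> \oo] --> S (x + 2^-1 *: (x - S (S x))).
  apply: (@cvg_contraction X S (fun n => x + 2^-1 *: (x - X n (X n x)))).
  - exact: newton_seq_le.
  - exact: cvg_newton_sign.
  - apply: cvgD; first exact: cvg_cst.
    by apply: cvgZl_tmp; apply: cvgB => //; exact: cvg_cst.
have h4 : X n.+1 x @[n --> \oo] --> S x.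
  by have := h1; rewrite -(cvg_shiftS (fun n => X n x)).
have : S (x + 2^-1 *: (x - S (S x))) = S x.
  by apply: cvg_unique h3 h4; exact: norm_hausdorff.
rewrite op_linD op_linZ => /eqP; rewrite -subr_eq0 addrAC subrr add0r.
rewrite scaler_eq0 invr_eq0 pnatr_eq0 orFb op_linD op_linN subr_eq0.
by move=> /eqP.
Qed.

Lemma newton_sign_comm : S * A = A * S.
Proof.
apply: op_ext => x; rewrite !opE.
apply: (cvg_unique (@norm_hausdorff _ _) (@cvg_newton_sign (A x))).
have -> : (fun n => X n (A x)) = (fun n => A (X n x)).
  apply/funext => n.
  by rewrite -!opME (newton_seq_comm _ (erefl (A * A))).
apply: (@cvg_contraction (fun=> A) A (fun n => X n x)).
- by move=> _; exact: gap_le.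
- exact: cvg_cst.
- exact: cvg_newton_sign.
Qed.

Lemma newton_sign_pos : pos dot (S * A).
Proof.
move=> x; rewrite opE; have h := cvg_dotl (y := x) (@cvg_newton_sign (A x)).
by apply: cvg_ge0 h _ => n; apply: newton_seq_pos.
Qed.

(** The sequence [|X_n x|] is nondecreasing from [|A x|], so [A x] vanishes as
soon as the limit does. *)
Lemma newton_sign_ker x : (A x = 0) <-> (S x = 0).
Proof.
split=> [Ax|Sx].
  apply: (cvg_unique (@norm_hausdorff _ _) (@cvg_newton_sign x)).
  have -> : (fun n => X n x) = (fun=> 0).
    by apply/funext => n; exact: newton_seq_ker.
  exact: cvg_cst.
apply/eqP; rewrite -normr_le0 -oppr_ge0 -[X in 0 <= X]add0r.
apply: (@cvg_ge0 K (fun n => `|X n x| - `|A x|)).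
  rewrite -(normr0 H) -Sx; apply: cvgB; last exact: cvg_cst.
  by apply: cvg_norm; exact: cvg_newton_sign.
move=> n; rewrite subr_ge0 -(@ler_pXn2r _ 2)// ?nnegrE// -subr_ge0.
apply: le_trans (newton_seq_dist norm_dot A_adj A_gap n x).
by rewrite exprn_ge0.
Qed.

Lemma newton_sign_mem (M : set B) :
  von_neumann_algebra dot M -> M A -> M S.
Proof.
move=> vM MA; apply: (@wot_closed M X S); first exact: vn_closed vM.
  elim=> //= n ih; rewrite /newton /half_gap.
  apply: (vn_mul vM) => //; apply: (vn_add vM); first exact: vn_one vM.
  apply: (vn_scale vM); apply: (vn_add vM); first exact: vn_one vM.
  rewrite -scaleN1r; apply: (vn_scale vM); exact: (vn_mul vM).
exact: cvg_newton_sign.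
Qed.
End NewtonLimit.
End Limits.

(** * Projections of a von Neumann algebra *)

Section VonNeumann.
Variables (R : realType) (H : completeNormedModType R[i]).
Variable dot : {dot H for (@Num.conj R[i])}.
Hypothesis norm_dot : forall x : H, `|x| ^+ 2 = dot x x.
Local Notation K := R[i].
Local Notation B := (bounded_operator H).
Variable M : set B.
Hypothesis M_vN : von_neumann_algebra dot M.
Implicit Types (S T X Y P E A : B) (x y : H).

Lemma vn_opp T : M T -> M (- T).
Proof. by move=> MT; rewrite -scaleN1r; apply: (vn_scale M_vN). Qed.

Lemma vn_sub S T : M S -> M T -> M (S - T).
Proof. by move=> MS MT; apply: (vn_add M_vN) => //; exact: vn_opp. Qed.

Lemma gap_of_le A : is_adjoint dot A A -> (forall x, `|A x| <= `|x|) ->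
  pos dot (half_gap A).
Proof.
move=> aA hA x; rewrite /half_gap !opE dotZl mulr_ge0// dotDl dotNl aA.
by rewrite -!norm_dot subr_ge0 ler_pXn2r ?nnegrE.
Qed.

Lemma scale_to_contraction T : is_adjoint dot T T ->
  exists2 c : K, 0 < c & is_adjoint dot (c *: T) (c *: T) /\
                         pos dot (half_gap (c *: T)).
Proof.
move=> aT; have [k k0 Tk] := operator_bounded T.
have k1 : 0 < k + 1 by rewrite ltr_wpDl.
have ac : is_adjoint dot ((k + 1)^-1 *: T) ((k + 1)^-1 *: T).
  have h : ((k + 1)^-1)^* = (k + 1)^-1 by rewrite geC0_conj// invr_ge0 ltW.
  by rewrite -{2}h; apply: adjointZ.
exists (k + 1)^-1; [by rewrite invr_gt0|split=> //; apply: gap_of_le => // x].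
rewrite opE normrZ gtr0_norm ?invr_gt0// ler_pdivrMl// mulrDl mul1r.
by rewrite (le_trans (Tk x))// lerDl.
Qed.

Lemma adjoint_mul_ker X X' x : is_adjoint dot X X' -> (X' * X) x = 0 -> X x = 0.
Proof.
move=> aX h; apply/eqP; rewrite -(dnorm_eq0 dot) aX -opME h dot0r//.
Qed.

(** If [S] is the sign of a multiple of [X' X], where [X'] is the adjoint of
[X], then [S ^ 2] is the projection onto the orthogonal complement of the
kernel of [X]. *)
Lemma range_projection X : M X -> exists E,
  [/\ M E, projection dot E & forall x, E x = 0 <-> X x = 0].
Proof.
move=> MX; have [X' MX' aX] := vn_adjoint M_vN MX.
have aXX : is_adjoint dot (X' * X) (X' * X).
  by apply: adjointM => //; apply: adjointC.
have [c c0 [aA gA]] := scale_to_contraction aXX.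
set A := c *: (X' * X) in aA gA.
have MA : M A by apply: (vn_scale M_vN); exact: (vn_mul M_vN).
pose S := newton_sign norm_dot aA gA.
have S3 : S * S * S = S by exact: newton_sign_cube.
have aS : is_adjoint dot S S by exact: newton_sign_adjoint.
have MS : M S by exact: newton_sign_mem.
exists (S * S); split.
- exact: (vn_mul M_vN).
- by split; [rewrite mulrA S3|apply: adjointM].
move=> x; have SE : (S * S) x = 0 <-> S x = 0.
  split=> [h|h]; last by rewrite opE h op_lin0.
  by rewrite -S3 -mulrA opE h op_lin0.
have SA : A x = 0 <-> S x = 0 by exact: newton_sign_ker.
have AX : A x = 0 <-> X x = 0.
  split=> [h|h]; last by rewrite /A !opE h op_lin0 scaler0.
  apply: (adjoint_mul_ker aX); apply/eqP; move/eqP: h.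
  by rewrite /A opE scaler_eq0 gt_eqF.
by tauto.
Qed.

Lemma vn_semiprime X : M X -> (forall Y, M Y -> X * Y * X = 0) -> X = 0.
Proof.
move=> MX h; have [X' MX' aX] := vn_adjoint M_vN MX.
apply: op_ext => x; rewrite op0E; apply: (adjoint_mul_ker aX).
have aX' := adjointC aX.
by apply: (adjoint_mul_ker aX'); rewrite -opME h.
Qed.

(** A projection [E] that annihilates all off-diagonal corners cuts out a
commutative central summand. *)
Section Localized.
Variable E : B.
Hypothesis E_M : M E.
Hypothesis E_proj : projection dot E.
Hypothesis E_corner : forall P T, M P -> projection dot P -> M T ->
  E * (P * T * (1 - P)) = 0.

Let EE : E * E = E := E_proj.1.

(** The corner condition for [E] itself says that [E T = E T E]; the adjoint of
this equality for the adjoint of [T] is [T E = E T E]. *)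
Lemma localized_central T : M T -> E * T = T * E.
Proof.
have h T' : M T' -> E * T' = E * T' * E.
  move=> MT'; have := E_corner E_M E_proj MT'.
  by rewrite mulrBr mulr1 mulrBr !mulrA EE => /eqP; rewrite subr_eq0 => /eqP.
move=> MT; rewrite h//; have [T' MT' aT] := vn_adjoint M_vN MT.
have aE := E_proj.2.
apply: (@adjoint_inj _ _ dot (E * T')).
  rewrite h// -[E * T * E]mulrA; apply: adjointM => //; apply: adjointM => //.
  exact: adjointC.
by apply: adjointM => //; exact: adjointC.
Qed.

Lemma localized_projection_comm P T : M P -> projection dot P -> M T ->
  E * (P * T - T * P) = 0.
Proof.
move=> MP pP MT; have h1 := E_corner MP pP MT.
have M1P : M (1 - P) by apply: vn_sub => //; exact: vn_one M_vN.
have p1P : projection dot (1 - P).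
  split; last by apply: adjointD => //; apply: adjointN; exact: pP.2.
  by rewrite mulrBr mulr1 mulrBl mul1r pP.1 subrr subr0.
have := E_corner M1P p1P MT; rewrite subKr => h2.
transitivity (E * (P * T * (1 - P)) - E * ((1 - P) * T * P)); last first.
  by rewrite h1 h2 subr0.
by ncring.
Qed.

(** One step of the dyadic expansion of [A].  Take for [U] the sign of [A],
completed by [1] on the kernel of [A].  Then [C = U A] is the absolute value of
[A], and [2 A - U] is again a contraction because
[1 - (2 A - U) ^ 2 = 4 (C - C ^ 2)] and
[C - C ^ 2 = C (1 - C) C + (1 - C) C (1 - C)] is positive. *)
Lemma contraction_splitting A : M A -> is_adjoint dot A A ->
  pos dot (half_gap A) -> exists U,
  [/\ is_adjoint dot (A + A - U) (A + A - U), pos dot (half_gap (A + A - U)),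
      M (A + A - U) & forall T, M T -> E * (U * T - T * U) = 0].
Proof.
move=> MA aA gA; pose S := newton_sign norm_dot aA gA.
have S3 : S * S * S = S by exact: newton_sign_cube.
have aS : is_adjoint dot S S by exact: newton_sign_adjoint.
have MS : M S by exact: newton_sign_mem.
have SA : S * A = A * S by exact: newton_sign_comm.
have pSA : pos dot (S * A) by exact: newton_sign_pos.
have ASS : A * S * S = A.
  apply: op_ext => x; apply/eqP.
  rewrite -subr_eq0 -mulrA opME -op_linN -op_linD.
  apply/eqP/(newton_sign_ker norm_dot aA gA); rewrite -/S op_linD op_linN.
  by rewrite -opME mulrA S3 subrr.
clearbody S.
pose U := S + 1 - S * S.
have aU : is_adjoint dot U U.
  by do 2?apply: adjointD => //; apply/adjointN/adjointM.
have MU : M U.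
  apply: vn_sub; last exact: (vn_mul M_vN).
  by apply: (vn_add M_vN) => //; exact: vn_one M_vN.
have UU : U * U = 1.
  transitivity (1 + (S - S * S * S) + (S - S * S * S) + S * (S * S * S - S)).
    by rewrite /U; ncring.
  by rewrite S3 subrr mulr0 !addr0.
have UA : U * A = S * A.
  transitivity (S * A + (A - S * (S * A))); first by rewrite /U; ncring.
  by rewrite SA mulrA SA ASS subrr addr0.
have AU : A * U = S * A.
  transitivity (A * S + (A - A * S * S)); first by rewrite /U; ncring.
  by rewrite ASS subrr addr0 SA.
exists U; split.
- by do 2?apply: adjointD => //; exact: adjointN.
- set C := S * A.
  have aC : is_adjoint dot C C by rewrite /C {2}SA; apply: adjointM.
  have CC : C * C = A * A.
    by rewrite /C {1}SA mulrA -[A * S * S]mulrA; rewrite mulrA ASS.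
  have p1C : pos dot (1 - C).
    have -> : 1 - C = 2^-1 *: ((1 - C) * (1 - C)) + half_gap A.
      rewrite /half_gap -CC -scalerDr.
      rewrite [X in _ *: X](_ : _ = (1 - C) + (1 - C)); last by ncring.
      by rewrite scalerDr -scalerDl halfD scale1r.
    apply: posD => //; apply: posZ; first by rewrite invr_ge0.
    by apply: pos_sqr; apply: adjointD => //; exact: adjointN.
  have -> : half_gap (A + A - U) =
      (C * (1 - C) * C + (1 - C) * C * (1 - C)) +
      (C * (1 - C) * C + (1 - C) * C * (1 - C)).
    rewrite /half_gap; set D := C * (1 - C) * C + _.
    rewrite [X in _ *: X](_ : _ = D + D + (D + D)); last first.
      have -> : D = C - C * C by rewrite /D; ncring.
      transitivity (1 - (A * A + A * A + (A * A + A * A))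
        + (A * U + A * U) + (U * A + U * A) - U * U); first by ncring.
      by rewrite UA AU -CC UU -/C; ncring.
    by rewrite scalerDr -scalerDl halfD scale1r.
  have pD : pos dot (C * (1 - C) * C + (1 - C) * C * (1 - C)).
    apply: posD; apply: pos_conj => //; apply: adjointD => //.
    exact: adjointN.
  exact: posD.
- by apply: vn_sub => //; exact: (vn_add M_vN).
move=> T MT; pose P := 2^-1 *: (1 + U).
have PP : P + P = 1 + U by rewrite -scalerDl halfD scale1r.
have MP : M P.
  by apply: (vn_scale M_vN); apply: (vn_add M_vN) => //; exact: vn_one M_vN.
have pP : projection dot P.
  split; last first.
    have h : (2^-1 : K)^* = 2^-1 by rewrite geC0_conj// invr_ge0.
    by rewrite /P -{2}h; apply: adjointZ; exact: adjointD.
  rewrite {2}/P op_scalerAr mulrDr mulr1.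
  have -> : P * U = P.
    by rewrite /P op_scalerAl mulrDl mul1r UU addrC.
  by rewrite scalerDr -scalerDl halfD scale1r.
have -> : U = P + P - 1 by rewrite PP addrC addKr.
have h := localized_projection_comm MP pP MT.
transitivity (E * (P * T - T * P) + E * (P * T - T * P)); first by ncring.
by rewrite h addr0.
Qed.

Lemma localized_contraction_comm A T : M A -> is_adjoint dot A A ->
  pos dot (half_gap A) -> M T -> E * (A * T - T * A) = 0.
Proof.
move=> MA aA gA MT; have [k k0 Tk] := operator_bounded T.
have E1 x : `|E x| <= `|x|.
  apply: (gap_le norm_dot E_proj.2) => {x}; rewrite /half_gap EE.
  apply: posZ; first by rewrite invr_ge0.
  have -> : 1 - E = (1 - E) * (1 - E).
    by rewrite mulrBr mulr1 mulrBl mul1r EE subrr subr0.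
  by apply: pos_sqr; apply: adjointD => //; apply: adjointN; exact: E_proj.2.
(* Replacing [A] by [2 A - U] doubles [E (A T - T A)] since [E] annihilates the
   commutators of [U]. *)
have bound n : forall A, M A -> is_adjoint dot A A -> pos dot (half_gap A) ->
    forall x, 2 ^+ n * `|(E * (A * T - T * A)) x| <= (k + k) * `|x|.
  elim: n => [|n ih] {aA gA MA}A MA aA gA x.
    rewrite mul1r opME (le_trans (E1 _))// !opE (le_trans (ler_normB _ _))//.
    have A1 := gap_le norm_dot aA gA; rewrite mulrDl lerD//.
      exact: le_trans (A1 _) (Tk _).
    by rewrite (le_trans (Tk _))// ler_wpM2l.
  have [U [aU gU MU hU]] := contraction_splitting MA aA gA.
  have := ih _ MU aU gU x.
  have -> : E * ((A + A - U) * T - T * (A + A - U)) =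
      E * (A * T - T * A) + E * (A * T - T * A).
    rewrite -[RHS]subr0 -(hU T MT); by ncring.
  by rewrite opDE -mulr2n normrMn exprSr -mulrA mulr_natl.
apply: op_ext => x; apply/eqP; rewrite op0E -normr_eq0.
(* A positive [v] would make [2 ^+ n * v] exceed the bound for large [n]; the
   comparison takes place between real parts. *)
set v := `|_|; have v0 : 0 <= v by exact: normr_ge0.
apply/negP => /negP vn0; have {vn0}v0 : 0 < v by rewrite lt_neqAle eq_sym vn0.
set w := (k + k) * `|x|.
have w0 : 0 <= w by rewrite mulr_ge0// addr_ge0.
pose v' := complex.Re v; pose w' := complex.Re w.
have vE : v = v'%:C%C by rewrite RRe_real// gtr0_real.
have wE : w = w'%:C%C by rewrite RRe_real// ger0_real.
have v'0 : 0 < v' by rewrite -ltcR -vE.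
have w'0 : 0 <= w' by rewrite -lecR -wE.
have h := bound (Num.bound (w' / v')) A MA aA gA x.
have := archi_boundP (divr_ge0 w'0 (ltW v'0)).
rewrite ltr_pdivrMr// ltNge => /negP; apply.
rewrite -lecR -wE; apply: le_trans h.
rewrite rmorphM/= -vE ler_wpM2r ?(ltW v0)//.
have /= -> := rmorph_nat (real_complex R) (Num.bound (w' / v')).
by rewrite -natrX ler_nat ltnW// ltn_expl.
Qed.

Lemma localized_comm S T : M S -> M T -> E * (S * T - T * S) = 0.
Proof.
move=> MS MT.
have sa S' : M S' -> is_adjoint dot S' S' -> E * (S' * T - T * S') = 0.
  move=> MS' aS'; have [c c0 [ac gc]] := scale_to_contraction aS'.
  have := localized_contraction_comm (vn_scale M_vN c MS') ac gc MT.
  rewrite op_scalerAl op_scalerAr -scalerBr op_scalerAr => /eqP.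
  by rewrite scaler_eq0 gt_eqF// => /eqP.
have [S' MS' aS] := vn_adjoint M_vN MS.
have h1 : E * ((S + S') * T - T * (S + S')) = 0.
  apply: sa; first exact: (vn_add M_vN).
  by rewrite {2}addrC; apply: adjointD => //; exact: adjointC.
have h2 : E * ((S - S') * T - T * (S - S')) = 0.
  have : E * (('i *: (S - S')) * T - T * ('i *: (S - S'))) = 0.
    apply: sa; first by apply: (vn_scale M_vN); exact: vn_sub.
    have := adjointZ 'i (adjointD aS (adjointN (adjointC aS))).
    by rewrite conjCi scaleNr -scalerN opprB.
  rewrite op_scalerAl op_scalerAr -scalerBr op_scalerAr => /eqP.
  by rewrite scaler_eq0 (negbTE (neq0Ci _)) => /eqP.
have h3 : E * (S * T - T * S) + E * (S * T - T * S) = 0.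
  by rewrite -[RHS]addr0 -{1}h1 -h2; ncring.
by rewrite -[LHS]scale1r -halfD scalerDl -scalerDr h3 scaler0.
Qed.
End Localized.

Hypothesis M_noI1 : no_central_summand_of_type_I1 dot M.

(** The projection with the same kernel as [X] inherits the condition on [X],
so that it would cut out a commutative central summand if it were nonzero. *)
Lemma vn_corner_faithful X : M X ->
  (forall P T, M P -> projection dot P -> M T -> X * (P * T * (1 - P)) = 0) ->
  X = 0.
Proof.
move=> MX hX; have [E [ME pE kE]] := range_projection MX.
have hE P T : M P -> projection dot P -> M T -> E * (P * T * (1 - P)) = 0.
  move=> MP pP MT; apply: op_ext => x.
  by rewrite opME; apply/kE; rewrite -opME hX.
have E0 : E = 0.
  apply: contrapT => /eqP E0; apply: M_noI1; exists E; split=> //.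
    by split=> // T MT; exact: localized_central.
  move=> S T MS MT; have cS := localized_central ME pE hE MS.
  have cT := localized_central ME pE hE MT.
  rewrite mulrA -[E * S * E]mulrA -cS mulrA pE.1.
  rewrite [RHS]mulrA -[E * T * E]mulrA -cT [in RHS]mulrA pE.1.
  apply/eqP; rewrite -!mulrA -subr_eq0 -mulrBr; apply/eqP.
  exact: localized_comm.
by apply: op_ext => x; apply/kE; rewrite E0.
Qed.
End VonNeumann.

(** * The algebra as a ring *)

Section VonNeumannRing.
Variables (R : realType) (H : completeNormedModType R[i]).
Variables (dot : {dot H for (@Num.conj R[i])}) (M : set (bounded_operator H)).
Hypothesis M_vN : von_neumann_algebra dot M.
Local Notation B := (bounded_operator H).

(** The proof of [von_neumann_algebra dot M] is an argument of the predicate, so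
that the ring structure on the corresponding subtype can be found from it. *)
Definition vn_pred of von_neumann_algebra dot M : {pred B} := fun T => T \in M.

Lemma vn_predP T : reflect (M T) (T \in vn_pred M_vN).
Proof. by apply: (iffP idP) => [/set_mem|/mem_set]. Qed.

Lemma vn_subring_closed : GRing.subring_closed (vn_pred M_vN).
Proof.
split; first by apply/vn_predP; exact: vn_one M_vN.
  by move=> S T /vn_predP MS /vn_predP MT; apply/vn_predP; exact: (vn_sub M_vN).
by move=> S T /vn_predP MS /vn_predP MT; apply/vn_predP; exact: (vn_mul M_vN).
Qed.

Definition vn_ring := {T : B | T \in vn_pred M_vN}.

HB.instance Definition _ := SubChoice.on vn_ring.
HB.instance Definition _ :=
  GRing.SubChoice_isSubPzRing.Build B (vn_pred M_vN) vn_ring vn_subring_closed.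

Lemma vn_scale_mem (xi : R[i]) (T : vn_ring) : xi *: \val T \in vn_pred M_vN.
Proof. by apply/vn_predP/(vn_scale M_vN)/vn_predP; exact: valP. Qed.

Definition vn_scaling (xi : R[i]) (T : vn_ring) : vn_ring :=
  exist _ (xi *: \val T) (vn_scale_mem xi T).

Lemma vn_scaling_is_zmod_morphism (xi : R[i]) : zmod_morphism (vn_scaling xi).
Proof. by move=> S T; apply: val_inj; rewrite /= scalerBr. Qed.

HB.instance Definition _ (xi : R[i]) :=
  GRing.isZmodMorphism.Build vn_ring vn_ring (vn_scaling xi)
    (vn_scaling_is_zmod_morphism xi).
End VonNeumannRing.

Theorem theorem1p2 (R : realType) (H : completeNormedModType R[i])
    (dot : {dot H for (@Num.conj R[i])})
    (norm_dot : forall x : H, `|x| ^+ 2 = dot x x)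
    (M : set (bounded_operator H))
    (M_vN : von_neumann_algebra dot M)
    (M_noI1 : no_central_summand_of_type_I1 dot M)
    (xi : R[i]) (xi_neq0 : xi != 0) (xi_neq1 : xi != 1)
    (Phi : {fun M >-> M})
    (Phi_lie : nonlinear_xi_lie_derivation xi Phi) :
  additive_derivation Phi /\
  (forall T : bounded_operator H, M T -> Phi (xi *: T) = xi *: Phi T).
Proof.
pose A := vn_ring M_vN.
pose Z : {additive A -> A} := vn_scaling xi.
have inM (T : A) : M (\val T) by apply/(vn_predP M_vN); exact: (valP T).
have PhiM T : M T -> M (Phi T) by exact: funS.
have Phi_mem (T : A) : Phi (\val T) \in vn_pred M_vN.
  by apply/vn_predP/PhiM.
pose phi (T : A) : A := exist _ (Phi (\val T)) (Phi_mem T).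
have lift T : M T -> {T' : A | \val T' = T}.
  by move=> /(vn_predP M_vN) MT; exists (exist _ T MT).
have ZMl (x y : A) : Z x * y = Z (x * y).
  by apply: val_inj; rewrite /= op_scalerAl.
have ZMr (x y : A) : x * Z y = Z (x * y).
  by apply: val_inj; rewrite /= op_scalerAr.
have scale_inj (a : R[i]) (T : bounded_operator H) :
    a != 0 -> a *: T = 0 -> T = 0.
  by move=> a0 /eqP; rewrite scaler_eq0 (negbTE a0) => /eqP.
have Z_inj (x : A) : Z x = 0 -> x = 0.
  by move=> /(congr1 val)/= h; apply: val_inj; apply: scale_inj h.
have Z1_inj (x : A) : x - Z x = 0 -> x = 0.
  move=> /(congr1 val)/=; rewrite -{1}[\val x]scale1r -scalerBl => h.
  by apply: val_inj; apply: scale_inj h; rewrite subr_eq0 eq_sym.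
have Zp1 : (forall x : A, Z x = - x) \/ (forall x : A, x + Z x = 0 -> x = 0).
  have [xiN1|xiN1] := eqVneq xi (- 1); [left|right] => x.
    by apply: val_inj; rewrite /= xiN1 scaleN1r.
  move=> /(congr1 val)/=; rewrite -{1}[\val x]scale1r -scalerDl => h.
  by apply: val_inj; apply: scale_inj h; rewrite addrC addr_eq0.
have semiprime (x : A) : (forall y : A, x * y * x = 0) -> x = 0.
  move=> h; apply: val_inj => /=; apply: (vn_semiprime M_vN (inM x)) => T MT.
  by have [T' <-] := lift _ MT; have /(congr1 val) := h T'.
have faithful (x : A) :
    (forall e s : A, e * e = e -> x * (e * s * (1 - e)) = 0) -> x = 0.
  move=> h; apply: val_inj => /=.
  apply: (vn_corner_faithful norm_dot M_vN M_noI1 (inM x)).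
  move=> P T MP [PP _] MT.
  have [e eP] := lift _ MP; have [s sT] := lift _ MT.
  have ee : e * e = e by apply: val_inj; rewrite /= eP.
  by have /(congr1 val)/= := h e s ee; rewrite eP sT.
have phi_lie (x y : A) :
    phi (xlie Z x y) = xlie Z (phi x) y + xlie Z x (phi y).
  by apply: val_inj; exact: (Phi_lie _ _ (inM x) (inM y)).
have phiD := xlie_derivation_additive ZMl ZMr Z_inj Z1_inj semiprime
  faithful phi_lie.
have [phiM phiZ] := xlie_derivation_leibniz ZMl ZMr Z_inj Z1_inj semiprime
  faithful phi_lie Zp1.
split; last first.
  by move=> T /lift[t <-]; have /(congr1 val) := phiZ t.
split=> S T /lift[s <-] /lift[t <-].
  by have /(congr1 val) := phiD s t.
by have /(congr1 val) := phiM s t.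
Qed.
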